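(* For each $\beta \in (1,2]$ the mapping $u_\beta : [0,1]\to[0,1]$ defined by $u_\beta(x)=\beta x$ if $0\le x\le \frac12$ and $u_\beta(x)=\beta-\beta x$ if $\frac12\le x\le 1$ is essentially transitive.
   Context: Let $I=[0,1]$ and let $f:I\to I$ be continuous; $f^n$ denotes the $n$-th iterate ($f^0=\mathrm{id}_I$). A set $B\subset I$ is $f$-invariant if $f(B)\subset B$. A closed set $C\subset I$ is an $f$-cycle with period $m\ge 1$ if $C$ is the disjoint union of non-trivial closed intervals $B_0,\dots,B_{m-1}$ with $f(B_{k-1})\subset B_k$ for $1\le k\le m-1$ and $f(B_{m-1})\subset B_0$. An $f$-cycle $C$ is transitive if every closed $f$-invariant subset $F$ of $C$ satisfies $F=C$ or $\mathrm{int}(F)=\varnothing$. For $B\subset I$, $\mathrm{E}(B,f)=\{x\in I: f^n(x)\in B \text{ for some } n\ge 0\}$. The mapping $f$ is essentially transitive if there exists a transitive $f$-cycle $C$ such that $I\setminus \mathrm{E}(C,f)$ is countable (possibly finite or empty). *)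

(* Defs.v *)
From HB Require Import structures.
From mathcomp Require Export all_boot all_order all_algebra.
From mathcomp Require Export all_classical all_reals all_analysis.
Export Order.TTheory GRing.Theory Num.Theory.
Export numFieldNormedType.Exports.

Set Implicit Arguments.
Unset Strict Implicit.
Unset Printing Implicit Defensive.

Local Open Scope classical_set_scope.
Local Open Scope ring_scope.

(* A map I -> I is represented by a total function R -> R, of which only the  *)
(* values on I matter: all the notions below look at orbits of points of I.   *)

Definition unitI (R : realType) : set R := `[0, 1]%classic.
Arguments unitI : clear implicits.

Definition interval_map (R : realType) (f : R -> R) : Prop :=
  set_fun (unitI R) (unitI R) f /\ {within unitI R, continuous f}.

Definition invariant_set (R : realType) (f : R -> R) (B : set R) : Prop :=
  B `<=` unitI R /\ f @` B `<=` B.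

Definition nontrivial_closed_itv (R : realType) (B : set R) : Prop :=
  exists a b : R, a < b /\ B = `[a, b]%classic.

Definition is_cycle (R : realType) (f : R -> R) (C : set R) (m : nat) : Prop :=
  (0 < m)%N /\ C `<=` unitI R /\
  exists B : nat -> set R,
    [/\ forall k, (k < m)%N -> nontrivial_closed_itv (B k),
        trivIset `I_m B,
        C = \bigcup_(k < m) B k,
        forall k, (1 <= k <= m.-1)%N -> f @` B k.-1 `<=` B k
      & f @` B m.-1 `<=` B 0%N].

(* As I is closed in R, closedness in I and in R agree for subsets of I. The  *)
(* interior is taken in R; a subset of I has empty interior in R iff it has   *)
(* empty interior in I.                                                       *)
Definition transitive_cycle (R : realType) (f : R -> R) (C : set R) : Prop :=
  (exists m : nat, is_cycle f C m) /\
  forall F : set R, F `<=` C -> closed F -> invariant_set f F ->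
    F = C \/ F° = set0.

Definition eventual_set (R : realType) (B : set R) (f : R -> R) : set R :=
  [set x | unitI R x /\ exists n : nat, B (iter n f x)].

Definition essentially_transitive (R : realType) (f : R -> R) : Prop :=
  exists C : set R,
    transitive_cycle f C /\ countable (unitI R `\` eventual_set C f).

(* The two branches agree at 1/2. *)
Definition tent (R : realType) (beta : R) (x : R) : R :=
  if x <= 2^-1 then beta * x else beta - beta * x.

(* Main.v *)
(* Put I = [0, 1], t = beta / 2 and s = the image of t. Every interval has an    *)
(* image around 1/2, by expansion. If beta^2 > 2, expansion even forces an       *)
(* invariant set containing an interval to contain [s, t], while every orbit     *)
(* except those ending at 0 enters [s, t]. If beta^2 <= 2, an affine map         *)
(* ("zoom") from I onto [1 - p, p], p the positive fixed point, conjugates the   *)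
(* tent map of slope beta^2 to the second iterate of the one of slope beta. A    *)
(* cycle C for beta^2 gives the cycle zoom C `|` tent (zoom C) of twice the      *)
(* period for beta; its two halves meet only if 0 is in C, which happens only    *)
(* for beta^2 = 2, and in that case one uses the single interval [s, t] again.   *)
(* Finitely many squarings lead from any beta to the case beta^2 >= 2.           *)
Require Import Defs.
From mathcomp Require Import all_boot all_order all_algebra.
From mathcomp Require Import all_classical all_reals all_analysis.
From mathcomp Require Import ring lra zify.
Import Order.TTheory GRing.Theory Num.Theory.
Set Implicit Arguments.
Unset Strict Implicit.
Unset Printing Implicit Defensive.
Local Open Scope classical_set_scope.
Local Open Scope ring_scope.

(** Transitivity follows from a stronger property, [minimal_core]: an invariant subset of I that
    contains an interval contains all of C. For F inside C this leaves only F = C or empty interior.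
    If beta^2 > 2, the intervals inside F grow until one contains [1/2, t], whose image is the core
    ([minimal_core_large]). For smaller slopes the property is inherited from slope beta^2 through
    the conjugacy [tent_tent_zoom] ([minimal_core_zoom]).

    An orbit misses C only if it hits 0 or the zoomed copy of an exceptional point for beta^2. As
    every point has at most two preimages, countability passes from one level to the next
    ([zoom_union_eventual]). [attracting_core] bundles these facts with the cycle structure
    ([zoom_union_cycle]), and [attracting_core_exists] runs the induction. *)

Lemma expr_unbounded (R : realType) (b M : R) : 1 < b -> exists n : nat, M < b ^+ n.
Proof.
move=> b1; have bern n : 1 + n%:R * (b - 1) <= b ^+ n.
  elim: n => [|n IHn]; first by rewrite mul0r addr0.
  rewrite exprS -natr1.
  have : 0 <= n%:R * (b - 1) ^+ 2 by rewrite mulr_ge0// sqr_ge0.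
  have : b * (1 + n%:R * (b - 1)) <= b * b ^+ n by rewrite ler_pM2l//; lra.
  by lra.
have [M0|M0] := ltP M 0; first by exists 0%N; rewrite expr0; lra.
have d0 : 0 < b - 1 by lra.
have := archi_boundP (divr_ge0 M0 (ltW d0)); set n := Num.bound _ => Mn.
exists n; apply: lt_le_trans (bern n).
by move: Mn; rewrite ltr_pdivrMr//; lra.
Qed.

(** If Q failed, F would contain intervals of geometrically growing length, yet F lies in an
    interval of length 1. *)
Lemma itv_sub_growth (R : realType) (F : set R) (g : R) (Q : Prop) :
  1 < g -> F `<=` unitI R ->
  (forall a b, a < b -> `[a, b] `<=` F ->
     Q \/ exists a' b', g * (b - a) <= b' - a' /\ `[a', b'] `<=` F) ->
  (exists a b, a < b /\ `[a, b] `<=` F) -> Q.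
Proof.
move=> g1 FI step [a [b [ab abF]]]; apply: contrapT => nQ.
have long n : exists a' b', g ^+ n * (b - a) <= b' - a' /\ `[a', b'] `<=` F.
  elim: n => [|n [a' [b' [len F']]]]; first by exists a, b; rewrite expr0 mul1r.
  have gn : 0 < g ^+ n by apply: exprn_gt0; lra.
  have [|//|[a'' [b'' [len' F'']]]] := step a' b' _ F'; first by nra.
  by exists a'', b''; split => //; rewrite exprS; nra.
have [n gn] := expr_unbounded (b - a)^-1 g1.
have [a' [b' [len F']]] := long n.
have lt1 : 1 < b' - a'.
  apply: lt_le_trans len.
  by move: gn; rewrite -ltr_pdivrMr ?subr_gt0// div1r.
have := FI _ (F' a' _); have := FI _ (F' b' _).
rewrite /unitI /= !in_itv /= !lexx andbT /=.
have a'b' : a' <= b' by lra.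
by move=> /(_ a'b') /andP[_ ?] /(_ a'b') /andP[? _]; lra.
Qed.

(** * The tent map and its invariant core *)

Section tent_map.
Context {R : realType}.
Implicit Types (beta x y a b : R) (F C : set R).

Lemma tent_left beta x : x <= 2^-1 -> tent beta x = beta * x.
Proof. by rewrite /tent => ->. Qed.

Lemma tent_right beta x : 2^-1 <= x -> tent beta x = beta - beta * x.
Proof.
rewrite /tent; case: ifP => // x2 x2'.
have -> : x = 2^-1 by lra.
by field.
Qed.

Lemma tentE beta x : tent beta x = beta / 2 - beta * `|x - 2^-1|.
Proof.
have [x2|/ltW x2] := leP x 2^-1.
  by rewrite tent_left// ler0_norm ?subr_le0//; field.
by rewrite tent_right// ger0_norm ?subr_ge0//; field.
Qed.

Lemma continuous_tent beta : continuous (tent beta).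
Proof.
have -> : tent beta = fun x => beta / 2 - beta * `|x - 2^-1|.
  by apply/funext => x; exact: tentE.
move=> x; apply: cvgB; first exact: cvg_cst.
apply: cvgM; first exact: cvg_cst.
apply: cvg_norm; apply: cvgB; [exact: cvg_id | exact: cvg_cst].
Qed.

Lemma tent_unitI beta x : 1 < beta <= 2 -> 0 <= x <= 1 -> 0 <= tent beta x <= beta / 2.
Proof.
move=> /andP[b1 b2] /andP[x0 x1]; have [x2|/ltW x2] := leP x 2^-1.
  by rewrite tent_left//; apply/andP; split; nra.
by rewrite tent_right//; apply/andP; split; nra.
Qed.

Lemma tent_interval_map beta : 1 < beta <= 2 -> interval_map (tent beta).
Proof.
move=> hb; split; last exact/continuous_subspaceT/continuous_tent.
move=> x; rewrite /unitI /= !in_itv /= => /(tent_unitI hb)/andP[-> tx] /=.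
by case/andP: hb => ? ?; lra.
Qed.

(** The image of beta / 2 under the right branch, that is, the second iterate of 1/2. *)
Definition tent_bot beta : R := beta - beta * (beta / 2).

Definition tent_core beta : set R := `[tent_bot beta, beta / 2].

Lemma tent_core_stable beta x : 1 < beta <= 2 ->
  tent_core beta x -> tent_core beta (tent beta x).
Proof.
rewrite /tent_core /tent_bot /= !in_itv /= => hb /andP[sx xt].
have /(tent_unitI hb)/andP[_ ->] : 0 <= x <= 1.
  by case/andP: hb => ? ?; apply/andP; split; nra.
rewrite andbT; case/andP: hb => b1 b2; have [x2|/ltW x2] := leP x 2^-1.
  by rewrite tent_left//; nra.
by rewrite tent_right//; nra.
Qed.

(** * Expansion of intervals and minimality of the core *)

Lemma itv_sub_tent_left beta a b : 0 < beta -> b <= 2^-1 ->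
  `[beta * a, beta * b] `<=` tent beta @` `[a, b].
Proof.
move=> b0 b2 y /=; rewrite in_itv /= => /andP[ay yb].
exists (y / beta); last first.
  rewrite tent_left; first by field; lra.
  by rewrite ler_pdivrMr//; nra.
by rewrite /= in_itv /= ler_pdivlMr// ler_pdivrMr//; apply/andP; split; lra.
Qed.

Lemma itv_sub_tent_right beta a b : 0 < beta -> 2^-1 <= a ->
  `[beta - beta * b, beta - beta * a] `<=` tent beta @` `[a, b].
Proof.
move=> b0 a2 y /=; rewrite in_itv /= => /andP[ay yb].
exists ((beta - y) / beta); last first.
  rewrite tent_right; first by field; lra.
  by rewrite ler_pdivlMr//; nra.
by rewrite /= in_itv /= ler_pdivlMr// ler_pdivrMr//; apply/andP; split; lra.
Qed.

Lemma sub_itv_tent_left beta F a b : 0 < beta -> tent beta @` F `<=` F ->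
  b <= 2^-1 -> `[a, b] `<=` F -> `[beta * a, beta * b] `<=` F.
Proof.
move=> b0 fF b2 abF; apply: subset_trans fF.
exact: subset_trans (itv_sub_tent_left b0 b2) (image_subset _ abF).
Qed.

Lemma sub_itv_tent_right beta F a b : 0 < beta -> tent beta @` F `<=` F ->
  2^-1 <= a -> `[a, b] `<=` F -> `[beta - beta * b, beta - beta * a] `<=` F.
Proof.
move=> b0 fF a2 abF; apply: subset_trans fF.
exact: subset_trans (itv_sub_tent_right b0 a2) (image_subset _ abF).
Qed.

Lemma sub_itv F a b a' b' : a <= a' -> b' <= b -> `[a, b] `<=` F -> `[a', b'] `<=` F.
Proof.
move=> aa bb abF x; rewrite /= in_itv /= => /andP[ax xb].
by apply: abF; rewrite /= in_itv /=; apply/andP; split; lra.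
Qed.

(** An interval on one side of 1/2 is stretched by the factor beta, which cannot go on forever. *)
Lemma sub_itv_peak beta F : 1 < beta -> F `<=` unitI R -> tent beta @` F `<=` F ->
  (exists a b, a < b /\ `[a, b] `<=` F) ->
  exists a b, [/\ a < 2^-1, 2^-1 < b & `[a, b] `<=` F].
Proof.
move=> b1 FI fF; apply: (itv_sub_growth b1 FI) => a' b' ab abF.
have b0 : 0 < beta by lra.
have [b2|b2] := leP b' 2^-1.
  right; exists (beta * a'), (beta * b'); split; first by lra.
  exact: sub_itv_tent_left.
have [a2|a2] := leP 2^-1 a'.
  right; exists (beta - beta * b'), (beta - beta * a'); split; first by lra.
  exact: sub_itv_tent_right.
by left; exists a', b'.
Qed.

(** F ranges over subsets of I rather than of C, because the pullback of an invariant set along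
    [zoom] need not lie in C. *)
Definition minimal_core beta C := forall F, F `<=` unitI R -> tent beta @` F `<=` F ->
  (exists a b, a < b /\ `[a, b] `<=` F) -> C `<=` F.

(* An interval around 1/2 has an image [beta/2 - beta l, beta/2] with l at least *)
(* half its length; either this contains [1/2, beta/2], whose image is the core, *)
(* or its own image is longer than the initial interval by a factor beta^2 / 2.  *)
Lemma minimal_core_large beta : 1 < beta <= 2 -> 2 < beta ^+ 2 ->
  minimal_core beta (tent_core beta).
Proof.
move=> /andP[b1 b2] bb F FI fF.
have g1 : 1 < beta ^+ 2 / 2 by lra.
have b0 : 0 < beta by lra.
have gb : beta ^+ 2 / 2 <= beta by nra.
apply: (itv_sub_growth g1 FI) => a b ab abF.
have gab : beta ^+ 2 / 2 * (b - a) <= beta * (b - a) by rewrite ler_pM2r//; lra.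
have peak l : b - a <= 2 * l -> `[beta / 2 - beta * l, beta / 2] `<=` F ->
    tent_core beta `<=` F \/ exists a' b',
      beta ^+ 2 / 2 * (b - a) <= b' - a' /\ `[a', b'] `<=` F.
  move=> bal lF; have [c|c] := leP 2^-1 (beta / 2 - beta * l).
    right; eexists _, _; split; last exact: (sub_itv_tent_right b0 fF c lF).
    by nra.
  left; have cF : `[2^-1, beta / 2] `<=` F by apply: sub_itv lF; lra.
  have := sub_itv_tent_right b0 fF (lexx _) cF.
  by apply: sub_itv; rewrite /tent_bot; lra.
have [bc|bc] := leP b 2^-1.
  right; exists (beta * a), (beta * b); split; first by lra.
  exact: sub_itv_tent_left.
have [ac|ac] := leP 2^-1 a.
  right; exists (beta - beta * b), (beta - beta * a); split; first by lra.
  exact: sub_itv_tent_right.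
have [lr|rl] := leP (b - 2^-1) (2^-1 - a).
  apply: (peak (2^-1 - a)); first by lra.
  have /(sub_itv_tent_left b0 fF (lexx _)) : `[a, 2^-1] `<=` F by apply: sub_itv abF; lra.
  by apply: sub_itv; lra.
apply: (peak (b - 2^-1)); first by lra.
have /(sub_itv_tent_right b0 fF (lexx _)) : `[2^-1, b] `<=` F by apply: sub_itv abF; lra.
by apply: sub_itv; lra.
Qed.

(** * Orbits that never reach the core *)

Lemma tent_iter_unitI beta x n : 1 < beta <= 2 -> 0 <= x <= 1 ->
  0 <= iter n (tent beta) x <= 1.
Proof.
move=> hb x01; elim: n => //= n /(tent_unitI hb)/andP[-> h] /=.
by case/andP: hb => ? ?; lra.
Qed.

(** After one step an orbit is at most beta / 2, so one that misses the core stays below [tent_bot].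
    There the map is multiplication by beta, and a nonzero orbit would grow without bound. *)
Lemma tent_orbit beta x : 1 < beta <= 2 -> 0 <= x <= 1 ->
  exists n, iter n (tent beta) x = 0 \/ tent_core beta (iter n (tent beta) x).
Proof.
move=> hb x01; apply: contrapT => /forallNP never.
set y := tent beta x.
have b12 : 1 < beta /\ beta <= 2 by apply/andP.
have yE n : iter n (tent beta) y = iter n.+1 (tent beta) x by rewrite iterSr.
have below n : iter n (tent beta) y < tent_bot beta.
  have := never n.+1; rewrite -yE => /not_orP[_]; apply: contra_notT.
  rewrite -leNgt /tent_core /= in_itv /= => ->.
  rewrite yE /=.
  by have /andP[_ ->] := tent_unitI hb (tent_iter_unitI n hb x01).
have yn n : iter n (tent beta) y = beta ^+ n * y.
  elim: n => [|n IHn]; first by rewrite mul1r.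
  rewrite iterS tent_left -?IHn ?exprS ?IHn ?mulrA// -IHn.
  by apply/ltW/(lt_le_trans (below n)); rewrite /tent_bot; nra.
have y0 : 0 < y.
  have /andP[y0 _] := tent_unitI hb x01.
  by rewrite lt_neqAle y0 andbT; apply/eqP => y0'; apply: (never 1%N); left.
have [n] := expr_unbounded y^-1 (proj1 b12).
rewrite -div1r ltr_pdivrMr// -yn => yn1.
by have := below n; rewrite /tent_bot; nra.
Qed.

(** A value y has at most the two preimages y / beta and 1 - y / beta, one per branch. *)
Lemma countable_tent_preimage beta (A : set R) : beta != 0 ->
  countable A -> countable (tent beta @^-1` A).
Proof.
move=> b0 cA; pose G y := [set y / beta; 1 - y / beta].
have cG : countable (\bigcup_(y in A) G y).
  by apply: bigcup_countable => // y _; apply: finite_set_countable; rewrite /G.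
apply: sub_countable cG; apply: subset_card_le => x Ax.
exists (tent beta x) => //; have [x2|/ltW x2] := leP x 2^-1.
  by left; rewrite tent_left//; field.
by right; rewrite tent_right//; field.
Qed.

Lemma countable_tent_iter_preimage beta (A : set R) n : beta != 0 ->
  countable A -> countable [set x | A (iter n (tent beta) x)].
Proof.
move=> b0; elim: n A => [|n IHn] A cA //.
by apply: (IHn (tent beta @^-1` A)); exact: countable_tent_preimage.
Qed.

Lemma countable_not_eventual beta C (D : set R) : beta != 0 -> countable D ->
  (forall x, 0 <= x <= 1 ->
     exists n, D (iter n (tent beta) x) \/ C (iter n (tent beta) x)) ->
  countable (unitI R `\` eventual_set C (tent beta)).
Proof.
move=> b0 cD land.
have cDn : countable (\bigcup_n [set x | D (iter n (tent beta) x)]).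
  by apply: bigcup_countable => // n _; exact: countable_tent_iter_preimage.
apply: sub_countable cDn; apply: subset_card_le => x [Ix nE].
have [|n [Dn|Cn]] := land x; first by move: Ix; rewrite /unitI /= in_itv.
  by exists n.
by case: nE; split => //; exists n.
Qed.

Lemma tent_core_eventual beta : 1 < beta <= 2 ->
  countable (unitI R `\` eventual_set (tent_core beta) (tent beta)).
Proof.
move=> hb; apply: (@countable_not_eventual _ _ [set 0]) => // [|x x01].
  by case/andP: hb => ? ?; apply/eqP; lra.
exact: tent_orbit.
Qed.

Lemma tent_core_cycle beta : 1 < beta <= 2 -> is_cycle (tent beta) (tent_core beta) 1.
Proof.
move=> hb; have [b1 b2] : 1 < beta /\ beta <= 2 by apply/andP.
have stable : tent beta @` tent_core beta `<=` tent_core beta.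
  by move=> _ [x xC <-]; exact: tent_core_stable.
split => //; split.
  move=> x; rewrite /tent_core /tent_bot /unitI /= !in_itv /= => /andP[sx xt].
  by apply/andP; split; nra.
exists (fun=> tent_core beta); split => //.
- by move=> k _; exists (tent_bot beta), (beta / 2); split; rewrite ///tent_bot; nra.
- by move=> [|i] [|j].
- by rewrite bigcup_const//; exists 0%N.

Qed.

(** * Renormalization: from slope beta^2 to slope beta *)

Definition tent_fix beta : R := beta / (1 + beta).

(** Order-reversing affine map with 0 sent to p, 1 to 1 - p and 1/2 fixed, where p is
    [tent_fix beta]. *)
Definition zoom beta y : R := tent_fix beta - (2 * tent_fix beta - 1) * y.

Definition zoom_union beta C := zoom beta @` C `|` tent beta @` (zoom beta @` C).

Lemma tent_fixE beta : 1 < beta -> beta * tent_fix beta = beta - tent_fix beta.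
Proof. by move=> b1; rewrite /tent_fix; field; lra. Qed.

Lemma tent_fix_bounds beta : 1 < beta -> 2^-1 < tent_fix beta /\ tent_fix beta < 1.
Proof.
move=> b1; rewrite /tent_fix ltr_pdivlMr ?ltr_pdivrMr; [|lra..].
by split; lra.
Qed.

Lemma zoom_bounds beta y : 1 < beta -> 0 <= y <= 1 ->
  1 - tent_fix beta <= zoom beta y <= tent_fix beta.
Proof.
move=> b1 /andP[y0 y1]; have [p1 p2] := tent_fix_bounds b1.
by rewrite /zoom; apply/andP; split; nra.
Qed.

Lemma zoom_onto beta x : 1 < beta -> 1 - tent_fix beta <= x <= tent_fix beta ->
  exists2 y, 0 <= y <= 1 & zoom beta y = x.
Proof.
move=> b1 /andP[px xp]; have [p1 p2] := tent_fix_bounds b1.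
have d0 : 0 < 2 * tent_fix beta - 1 by lra.
exists ((tent_fix beta - x) / (2 * tent_fix beta - 1)).
  by rewrite ler_pdivlMr// ler_pdivrMr//; apply/andP; split; lra.
by rewrite /zoom; field; lra.
Qed.

Lemma zoom_inj beta : 1 < beta -> injective (zoom beta).
Proof.
move=> b1 x y; rewrite /zoom => /addrI /oppr_inj.
by have [p1 p2] := tent_fix_bounds b1; apply: mulfI; lra.
Qed.

(** On [1 - p, p] the tent map is smallest at the endpoints, both of which it sends to p. *)
Lemma tent_zoom_ge beta y : 1 < beta -> 0 <= y <= 1 -> beta ^+ 2 <= 2 ->
  tent_fix beta <= tent beta (zoom beta y).
Proof.
move=> b1 y01 bb; have /andP[z1 z2] := zoom_bounds b1 y01.
have pE := tent_fixE b1; have [z|/ltW z] := leP (zoom beta y) 2^-1.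
  by rewrite tent_left//; nra.
by rewrite tent_right//; nra.
Qed.

(** The first image is at least p > 1/2, so the second application uses the right branch. Since
    [zoom] swaps the two sides of 1/2, both members are affine on each side and can be compared
    there. *)
Lemma tent_tent_zoom beta y : 1 < beta -> 0 <= y <= 1 -> beta ^+ 2 <= 2 ->
  tent beta (tent beta (zoom beta y)) = zoom beta (tent (beta ^+ 2) y).
Proof.
move=> b1 y01 bb; have [p1 p2] := tent_fix_bounds b1.
have fz := tent_zoom_ge b1 y01 bb.
rewrite [LHS]tent_right; last by lra.
have pE := tent_fixE b1.
have ppE : beta * (beta * tent_fix beta) = beta * (beta - tent_fix beta) by rewrite pE.
have [y2|/ltW y2] := leP y 2^-1.
  by rewrite (tent_left _ y2) tent_right /zoom; [lra|nra].
by rewrite (tent_right _ y2) tent_left /zoom; [lra|nra].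
Qed.

Lemma expr2_bounds beta : 1 < beta -> beta ^+ 2 <= 2 -> 1 < beta ^+ 2 <= 2.
Proof. by move=> b1 ->; rewrite andbT; nra. Qed.

Lemma iter_tent_zoom beta y n : 1 < beta -> 0 <= y <= 1 -> beta ^+ 2 <= 2 ->
  iter n.*2 (tent beta) (zoom beta y) = zoom beta (iter n (tent (beta ^+ 2)) y).
Proof.
move=> b1 y01 bb; elim: n => //= n ->.
by rewrite tent_tent_zoom//; apply: tent_iter_unitI => //; exact: expr2_bounds.
Qed.

(** The inequality amounts to (beta - 1) (beta^2 - 2) <= 0. *)
Lemma tent_bot_ge beta : 1 < beta -> beta ^+ 2 <= 2 -> 1 - tent_fix beta <= tent_bot beta.
Proof.
by move=> b1 bb; have := tent_fixE b1; rewrite /tent_bot; nra.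
Qed.

Lemma minimal_core_zoom beta C : 1 < beta -> beta ^+ 2 <= 2 ->
  C `<=` unitI R -> minimal_core (beta ^+ 2) C -> minimal_core beta (zoom_union beta C).
Proof.
move=> b1 bb CI minC F FI fF /(sub_itv_peak b1 FI fF)[a [b [a2 b2 abF]]].
have /andP[hbb _] := expr2_bounds b1 bb.
have [p1 p2] := tent_fix_bounds b1.
pose F' := [set y | unitI R y /\ F (zoom beta y)].
have a0 : 0 <= a.
  have /FI : F a by apply: abF; rewrite /= in_itv /= lexx; lra.
  by rewrite /unitI /= in_itv /= => /andP[].
have CF' : C `<=` F'.
  apply: minC => [y []//|_ [y [Iy Fy] <-]|].
    have y01 : 0 <= y <= 1 by move: Iy; rewrite /unitI /= in_itv.
    split.
      have /andP[t0 t1] := tent_unitI (expr2_bounds b1 bb) y01.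
      by rewrite /unitI /= in_itv /=; apply/andP; split; lra.
    rewrite -tent_tent_zoom//; apply: (fF); eexists; last by [].
    by apply: (fF); exists (zoom beta y).
  (* [zoom] fixes 1/2, reverses order and contracts by 2p - 1 < 1, so it maps [1/2, 1 - a] into
     [a, 1/2]. *)
  exists 2^-1, (1 - a); split; first by lra.
  move=> y /=; rewrite in_itv /= => /andP[y2 ya]; split.
    by rewrite /unitI /= in_itv /=; apply/andP; split; lra.
  by apply: abF; rewrite /= in_itv /= /zoom; apply/andP; split; nra.
have zF : zoom beta @` C `<=` F by move=> _ [y /CF'[_ Fy] <-].
move=> x [/zF//|[z /zF Fz <-]].
by apply: fF; exists z.
Qed.

Lemma zoom_union_eventual beta C : 1 < beta -> beta ^+ 2 <= 2 ->
  countable (unitI R `\` eventual_set C (tent (beta ^+ 2))) ->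
  countable (unitI R `\` eventual_set (zoom_union beta C) (tent beta)).
Proof.
move=> b1 bb cE; have hb : 1 < beta <= 2 by apply/andP; split => //; nra.
have b0 : beta != 0 by apply/eqP; lra.
set N := unitI R `\` _ in cE.
(* One index for the orbits ending at 0, one for the zoomed points whose orbit at slope beta^2
   misses C. *)
pose D (i : bool) : set R := if i then [set 0] else zoom beta @` N.
have cD : countable (\bigcup_i D i).
  apply: bigcup_countable => // -[] _ /=.
    exact: countable1.
  exact: sub_countable (card_image_le _ _) cE.
apply: (countable_not_eventual b0 cD) => x x01.
have [n [n0|nC]] := tent_orbit hb x01; first by exists n; left; exists true.
set z := iter n _ x in nC.
have [k /(zoom_onto b1)[y y01 yz]] : exists k,
    1 - tent_fix beta <= iter k (tent beta) z <= tent_fix beta.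
  have := tent_bot_ge b1 bb.
  have := tent_core_stable hb nC.
  move: nC; rewrite /tent_core /= !in_itv /= => /andP[zs zt] /andP[fs _] ps.
  (* A core point to the right of p is sent to at most p, as the right branch decreases; stability
     of the core and [tent_bot_ge] give the lower bound 1 - p. *)
  have [zp|zp] := leP z (tent_fix beta).
    by exists 0%N; rewrite /= zp andbT; lra.
  exists 1%N => /=; have [p1 p2] := tent_fix_bounds b1.
  apply/andP; split; first by lra.
  have := tent_fixE b1; rewrite tent_right; last by lra.
  by nra.
have [[_ [j Cj]]|nE] := pselect (eventual_set C (tent (beta ^+ 2)) y).
  exists (j.*2 + (k + n))%N; right; left.
  by rewrite 2!iterD -/z -yz iter_tent_zoom//.
exists (k + n)%N; left; exists false => //.
by rewrite iterD -/z -yz; exists y.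
Qed.

(** * The cycle of doubled period *)

(** If the interval straddles 1/2, symmetry makes the image of its longer half contain that of the
    shorter one. *)
Lemma tent_image_itv beta a b : 0 < beta -> a < b ->
  nontrivial_closed_itv (tent beta @` `[a, b]).
Proof.
move=> b0 ab; have [b2|b2] := leP b 2^-1.
  exists (beta * a), (beta * b); split; first by rewrite ltr_pM2l.
  apply/seteqP; split; last exact: itv_sub_tent_left.
  move=> _ [x /= + <-]; rewrite !in_itv /= => /andP[ax xb].
  by rewrite tent_left ?ler_pM2l ?ax//; lra.
have [a2|a2] := leP 2^-1 a.
  exists (beta - beta * b), (beta - beta * a); split; first by nra.
  apply/seteqP; split; last exact: itv_sub_tent_right.
  move=> _ [x /= + <-]; rewrite !in_itv /= => /andP[ax xb].
  by rewrite tent_right ?lerD2l ?lerN2 ?ler_pM2l ?ax ?xb//; lra.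
have [lr|rl] := leP (b - 2^-1) (2^-1 - a).
  exists (beta * a), (beta * 2^-1); split; first by rewrite ltr_pM2l.
  apply/seteqP; split.
    move=> _ [x /= + <-]; rewrite !in_itv /= => /andP[ax xb].
    have [x2|/ltW x2] := leP x 2^-1.
      by rewrite tent_left// !ler_pM2l// ax.
    by rewrite tent_right//; apply/andP; split; nra.
  apply: subset_trans (itv_sub_tent_left b0 (lexx _)) (image_subset _ _).
  by apply: sub_itv (@subset_refl _ _); lra.
exists (beta - beta * b), (beta - beta * 2^-1); split; first by nra.
apply/seteqP; split.
  move=> _ [x /= + <-]; rewrite !in_itv /= => /andP[ax xb].
  have [x2|/ltW x2] := leP x 2^-1.
    by rewrite tent_left//; apply/andP; split; nra.
  by rewrite tent_right//; apply/andP; split; nra.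
apply: subset_trans (itv_sub_tent_right b0 (lexx _)) (image_subset _ _).
by apply: sub_itv (@subset_refl _ _); lra.
Qed.

Lemma zoom_image_itv beta a b : 1 < beta -> a < b ->
  zoom beta b < zoom beta a /\
  zoom beta @` `[a, b] = `[zoom beta b, zoom beta a]%classic.
Proof.
move=> b1 ab; have [p1 p2] := tent_fix_bounds b1.
have d0 : 0 < 2 * tent_fix beta - 1 by lra.
split; first by rewrite /zoom ltrD2l ltrN2 ltr_pM2l.
apply/seteqP; split=> [_ [x /= + <-]|x /=].
  by rewrite !in_itv /= /zoom !lerD2l !lerN2 !ler_pM2l// andbC.
rewrite /zoom in_itv /= => /andP[bx xa].
exists ((tent_fix beta - x) / (2 * tent_fix beta - 1)); last by field; lra.
by rewrite /= in_itv /= ler_pdivlMr// ler_pdivrMr//; apply/andP; split; lra.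
Qed.

(** Keeps 0 out of the new cycle, so that [zoom_union_cycle] applies again at the next level. *)
Lemma zoom_union_pos beta C : 1 < beta -> beta ^+ 2 <= 2 -> C `<=` unitI R ->
  zoom_union beta C `<=` [set x | 0 < x <= 1].
Proof.
move=> b1 bb CI x; have [p1 p2] := tent_fix_bounds b1.
have unit y : C y -> 0 <= y <= 1 by move/CI; rewrite /unitI /= in_itv.
case=> [[y /unit y01 <-]|[_ [y /unit y01 <-] <-]] /=.
  by have /andP[? ?] := zoom_bounds b1 y01; apply/andP; split; lra.
have z := zoom_bounds b1 y01; have tz := tent_zoom_ge b1 y01 bb.
have b2 : beta <= 2 by nra.
have hb : 1 < beta <= 2 by rewrite b1.
have z01 : 0 <= zoom beta y <= 1 by case/andP: z => ? ?; apply/andP; split; lra.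
by have /andP[? ?] := tent_unitI hb z01; apply/andP; split; lra.
Qed.

(** The pieces alternate: a zoomed interval, then its image, whose own image falls in the next
    zoomed interval. *)
Lemma zoom_union_cycle beta C m : 1 < beta -> beta ^+ 2 <= 2 -> ~ C 0 ->
  is_cycle (tent (beta ^+ 2)) C m -> is_cycle (tent beta) (zoom_union beta C) m.*2.
Proof.
move=> b1 bb C0 [m0 [CI [B [Bitv Btriv CB Bstep Blast]]]].
have [p1 p2] := tent_fix_bounds b1.
have b0 : 0 < beta by lra.
have unit y : C y -> 0 <= y <= 1 by move/CI; rewrite /unitI /= in_itv.
have BC k : (k < m)%N -> B k `<=` C by move=> km; rewrite CB => x Bx; exists k.
have ffz k y : (k < m)%N -> B k y ->
    tent beta (tent beta (zoom beta y)) = zoom beta (tent (beta ^+ 2) y).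
  by move=> km /(BC _ km)/unit y01; exact: tent_tent_zoom.
(* Cyclic successor, merging the step clause and the wrap-around clause of a cycle. *)
pose next k := if k.+1 == m then 0%N else k.+1.
have next_m k : (k < m)%N -> (next k < m)%N.
  by move=> km; rewrite /next; case: eqP => // /eqP; lia.
have Bnext k y : (k < m)%N -> B k y -> B (next k) (tent (beta ^+ 2) y).
  move=> km By; rewrite /next; case: eqP => [kE|/eqP kE].
    by apply: Blast; exists y => //; rewrite -kE.
  by apply: (Bstep k.+1); [lia|exists y].
have Binj i j y : (i < m)%N -> (j < m)%N -> B i y -> B j y -> i = j.
  by move=> im jm Bi Bj; apply: (Btriv i j) => //; exists y.
pose D j := if odd j then tent beta @` (zoom beta @` B j./2) else zoom beta @` B j./2.
have half j : (j < m.*2)%N -> (j./2 < m)%N by lia.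
have Deven k : D k.*2 = zoom beta @` B k by rewrite /D odd_double doubleK.
have Dodd k : D k.*2.+1 = tent beta @` (zoom beta @` B k).
  by rewrite /D /= odd_double uphalf_double.
have fD j : (j < m.*2)%N -> tent beta @` D j `<=` D (if j.+1 == m.*2 then 0%N else j.+1).
  rewrite -(odd_double_half j); move: (odd j) j./2 => [] k.
    rewrite add1n Dodd => jm _ [_ [_ [y By <-] <-] <-]; rewrite (ffz k)//; last by lia.
    have -> : (if k.*2.+2 == m.*2 then 0 else k.*2.+2)%N = (next k).*2.
      by rewrite /next -doubleS (inj_eq double_inj); case: ifP.
    by rewrite Deven; exists (tent (beta ^+ 2) y) => //; apply: Bnext => //; lia.
  by rewrite add0n => jm; rewrite ifF ?Dodd ?Deven//; apply/eqP; lia.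
split; first by rewrite double_gt0.
split=> [x /(zoom_union_pos b1 bb CI)|].
  by rewrite /unitI /= in_itv /= => /andP[/ltW -> ->].
exists D; split.
- move=> k /half km; have [a [b [ab Bab]]] := Bitv _ km.
  have [zlt zE] := zoom_image_itv b1 ab.
  rewrite /D Bab zE; case: odd; first exact: tent_image_itv.
  by exists (zoom beta b), (zoom beta a).
(* Even pieces lie at or below p and odd ones at or above it; p itself is [zoom] of 0, which is not
   in C. *)
- have parity i j x : (i < m)%N -> (j < m)%N -> D i.*2 x -> D j.*2.+1 x -> False.
    move=> im jm; rewrite Deven Dodd => -[y By <-] [_ [y' By' <-]] yE.
    have := tent_zoom_ge b1 (unit _ (BC _ jm _ By')) bb; rewrite yE /zoom.
    have /andP[y0 _] := unit _ (BC _ im _ By).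
    have : y != 0 by apply/eqP => y00; apply: C0; rewrite -y00; exact: (BC i).
    by move/eqP => yn0; have : 0 < y; [lra|nra].
  move=> i j im jm [x [Di Dj]]; move: im jm Di Dj => /=.
  rewrite -(odd_double_half i) -(odd_double_half j).
  move: i./2 j./2 => k l; case: (odd i); case: (odd j);
    rewrite ?add0n ?add1n => im jm Di Dj.
  (* Two odd pieces that meet have images that meet in zoomed intervals; disjointness there equates
     the successors, hence the indices. *)
  + move: Di Dj; rewrite !Dodd => -[_ [y By <-] <-] [_ [y' By' <-]] /(congr1 (tent beta)).
    have km : (k < m)%N by lia.
    have lm : (l < m)%N by lia.
    rewrite (ffz k y)// (ffz l y')// => /(zoom_inj b1) yy'.
    have : next k = next l.
      apply: (Binj _ _ (tent (beta ^+ 2) y)); try exact: next_m.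
        exact: Bnext.
      by rewrite -yy'; exact: Bnext.
    by rewrite /next; case: eqP; case: eqP; lia.
  + by case: (parity l k x) => //; lia.
  + by case: (parity k l x) => //; lia.
  + move: Di Dj; rewrite !Deven => -[y By <-] [y' By'] /(zoom_inj b1) yy'.
    by congr _.*2; apply: (Binj _ _ y) => //; [lia..|rewrite -yy'].
- apply/seteqP; split=> [x [[y Cy <-]|[_ [y Cy <-] <-]]|x [j /= jm]].
  + move: Cy; rewrite CB => -[k /= km By]; exists k.*2; first by rewrite /= ltn_double.
    by rewrite Deven; exists y.
  + move: Cy; rewrite CB => -[k /= km By]; exists k.*2.+1; first by rewrite /=; lia.
    by rewrite Dodd; exists (zoom beta y) => //; exists y.
  + have BjC := BC _ (half _ jm); rewrite /D; case: odd.
      by move=> h; right; move: h; do 2 apply: image_subset.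
    by move=> h; left; move: h; apply: image_subset.
- move=> k /andP[k1 km]; have := @fD k.-1; rewrite prednK// ifF; first by apply; lia.
  by lia.
have := @fD m.*2.-1; rewrite prednK; last by lia.
by rewrite eqxx; apply; lia.
Qed.

(** * Induction on the number of squarings *)

(** The last clause feeds the disjointness of the doubled cycle; it is restricted to [beta < 2]
    because at slope 2 the core is all of I. *)
Definition attracting_core beta C :=
  [/\ exists m, is_cycle (tent beta) C m, minimal_core beta C,
      countable (unitI R `\` eventual_set C (tent beta)) & beta < 2 -> ~ C 0].

Lemma attracting_core_large beta : 1 < beta <= 2 -> 2 <= beta ^+ 2 ->
  attracting_core beta (tent_core beta).
Proof.
move=> hb bb; have [b1 b2] : 1 < beta /\ beta <= 2 by apply/andP.
split; first by exists 1%N; exact: tent_core_cycle.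
- have [|bb'] := ltP 2 (beta ^+ 2); first exact: minimal_core_large.
  (* Here the growth factor beta^2 / 2 is only 1, so minimality is transported from slope 2, and the
     core is shown to lie in the union of the two zoomed pieces. *)
  have bE : beta ^+ 2 = 2 by lra.
  have hb2 : 1 < beta ^+ 2 <= 2 by exact: expr2_bounds.
  have CI : tent_core (beta ^+ 2) `<=` unitI R.
    by have [_ []] := tent_core_cycle hb2.
  have minC : minimal_core (beta ^+ 2) (tent_core (beta ^+ 2)).
    by apply: minimal_core_large => //; rewrite bE; lra.
  have := minimal_core_zoom b1 bb' CI minC.
  move=> minz F FI fF /(minz F FI fF); apply: subset_trans.
  have core1 y : 0 <= y <= 1 -> tent_core (beta ^+ 2) y.
    rewrite /tent_core /tent_bot /= in_itv /= bE => /andP[y0 y1].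
    by apply/andP; split; lra.
  have ps := tent_bot_ge b1 bb'; have pE := tent_fixE b1.
  have [p1 p2] := tent_fix_bounds b1.
  move=> x; rewrite /tent_core /= in_itv /= => /andP[sx xt].
  have [xp|xp] := leP x (tent_fix beta).
    have [|y /core1 Cy <-] := @zoom_onto beta x b1; first by apply/andP; split; lra.
    by left; exists y.
  (* Above p, x is the image of x / beta, which lies in [1 - p, 1/2] since beta (1 - p) = p. *)
  have xb : x / beta <= 2^-1 by rewrite ler_pdivrMr; lra.
  have [|y /core1 Cy zE] := @zoom_onto beta (x / beta) b1.
    by apply/andP; split; [rewrite ler_pdivlMr; nra|lra].
  right; exists (zoom beta y); first by exists y.
  by rewrite zE tent_left//; field; lra.
- exact: tent_core_eventual.
- move=> b2'; rewrite /tent_core /tent_bot /= in_itv /= => /andP[+ _].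
  by apply/negP; rewrite -ltNge; nra.
Qed.

Lemma attracting_core_zoom beta C : 1 < beta -> beta ^+ 2 < 2 ->
  attracting_core (beta ^+ 2) C -> attracting_core beta (zoom_union beta C).
Proof.
move=> b1 bb [[m cyc] minC cE C0]; have bb' := ltW bb.
have CI : C `<=` unitI R by case: cyc => _ [].
split.
- by exists m.*2; apply: zoom_union_cycle => //; exact: C0.
- exact: minimal_core_zoom.
- exact: zoom_union_eventual.
- by move=> _ /(zoom_union_pos b1 bb' CI) /=; rewrite ltxx.
Qed.

Lemma attracting_core_exists beta : 1 < beta <= 2 -> exists C, attracting_core beta C.
Proof.
move=> hb; have [b1 b2] : 1 < beta /\ beta <= 2 by apply/andP.
have [k] : exists k, 2 <= beta ^+ (2 ^ k.+1).
  have [k bk] := expr_unbounded 2 b1; exists k.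
  apply: (le_trans (ltW bk)); rewrite ler_weXn2l//; first exact: ltW.
  exact/ltnW/(leq_trans (ltn_expl k _))/leq_pexp2l.
(* The hypothesis is applied to beta^2, which halves the exponent, so beta must vary. *)
elim: k => [|k IHk] in beta hb b1 b2 * => bk.
  by exists (tent_core beta); exact: attracting_core_large.
have [bb|bb] := leP 2 (beta ^+ 2).
  by exists (tent_core beta); exact: attracting_core_large.
have hb2 := expr2_bounds b1 (ltW bb).
have [||||C attrC] := IHk (beta ^+ 2) => //.
- by case/andP: hb2.
- by case/andP: hb2.
- by rewrite -exprM -expnS.
by exists (zoom_union beta C); exact: attracting_core_zoom.
Qed.

Lemma interior_sub_itv F : F° <> set0 -> exists a b, a < b /\ `[a, b] `<=` F.
Proof.
move/eqP/set0P => [x /nbhs_ballP[e /= e0 xeF]].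
exists (x - e / 2), (x + e / 2); split; first by lra.
move=> y; rewrite /= in_itv /= => /andP[xy yx]; apply: xeF.
by rewrite ball_itv /= in_itv /=; apply/andP; split; lra.
Qed.
End tent_map.

Theorem proposition3 (R : realType) (beta : R) (hbeta : 1 < beta <= 2) :
  interval_map (tent beta) /\ essentially_transitive (tent beta).
Proof.
split; first exact: tent_interval_map.
have [C [cyc minC cE _]] := attracting_core_exists hbeta.
exists C; split => //; split => // F FC _ [FI fF].
have [|/interior_sub_itv F0] := pselect (F° = set0); first by right.
by left; apply/seteqP; split => //; exact: minC.
Qed.
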